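(* Let $Q\in\mathcal{P}_2^{\rm in}$ be a planar convex polygon with $v$ vertices. If $\varphi:(0,\infty)\to(0,\infty)$ is concave and increasing, then $$S_\varphi(Q)\le 2vR(Q)\sin\frac{\pi}{v}\cdot\varphi\left(R(Q)\cos\frac{\pi}{v}\right).$$ Equality holds if and only if $Q$ is regular with incenter at the origin.
   Context: $\mathcal{P}_2^{\rm in}$ is the set of convex polygons $Q$ in $\mathbb{R}^2$ that contain the origin $o$ in their interiors and admit an incircle tangent to each edge of $Q$; the incenter is the center of this circle. $R(Q)$ is the radius of the smallest circle containing $Q$. For $Q$ with edges (facets) $F_1,\dots,F_{N_Q}$, $$S_\varphi(Q):=\sum_{j=1}^{N_Q}\varphi(\operatorname{dist}(o,F_j))\operatorname{vol}_1(F_j),$$ where $\operatorname{dist}(o,F_j)$ is the distance from $o$ to the affine hull of $F_j$ and $\operatorname{vol}_1(F_j)$ is the length of $F_j$.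
   Formalization: As φ(t)=t gives equality for every regular Q with o inside, ''equality only if the incenter is at the origin'' is proved only when φ is not affine near R(Q)cos(π/v); the inequality, ''if'', and ''equality implies Q regular'' are proved for all φ. *)

(* Defs.v *)
From HB Require Import structures.
From mathcomp Require Import all_boot all_order all_algebra.
From mathcomp Require Import all_classical all_reals all_analysis.

Set Implicit Arguments.
Unset Strict Implicit.
Unset Printing Implicit Defensive.

Import Order.TTheory GRing.Theory Num.Theory.
Import numFieldNormedType.Exports.

Local Open Scope classical_set_scope.
Local Open Scope ring_scope.

Section Plane.
Variable R : realType.

(* The library norm on 'rV[R]_2 is the sup norm: it provides the topology
   (hence interiors), but metric notions use the Euclidean distance below. *)
Notation point := 'rV[R]_2.

Definition dot (x y : point) : R := \sum_k x 0 k * y 0 k.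

Definition cross (x y : point) : R := x 0 0 * y 0 1 - x 0 1 * y 0 0.

Definition eudist (x y : point) : R := Num.sqrt (dot (x - y) (x - y)).

Definition dist_to (x : point) (A : set point) : R := inf [set eudist x y | y in A].

Definition circle (c : point) (r : R) : set point := [set x | eudist c x = r].

Definition disc (c : point) (r : R) : set point := [set x | eudist c x <= r].

Definition circumradius (A : set point) : R :=
  inf [set r : R | 0 <= r /\ exists c, A `<=` disc c r].

(* The affine hull of {a, b}. *)
Definition line (a b : point) : set point :=
  [set x | exists t : R, x = (1 - t) *: a + t *: b].

Definition segment (a b : point) : set point :=
  [set x | exists t : R, 0 <= t <= 1 /\ x = (1 - t) *: a + t *: b].

(* The angle a b c at b, in [0, pi]. *)
Definition angle (a b c : point) : R :=
  acos (dot (a - b) (c - b) / (eudist a b * eudist c b)).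

Section Polygon.
Variables (v : nat) (p : 'I_v -> point).

(* The convex hull of the p i. *)
Definition polygon : set point :=
  [set x | exists w : 'I_v -> R,
    [/\ forall i, 0 <= w i, \sum_i w i = 1 & x = \sum_i w i *: p i]].

(* [ordS] is the cyclic successor, so the edges are [p i, p (i + 1 mod v)]. *)
Definition edge (i : 'I_v) : set point := segment (p i) (p (ordS i)).

Definition edge_line (i : 'I_v) : set point := line (p i) (p (ordS i)).

Definition edge_length (i : 'I_v) : R := eudist (p i) (p (ordS i)).

(* p lists the vertices of a convex polygon in counterclockwise order: every
   other vertex is strictly to the left of each directed edge.  This forces the
   p i to be pairwise distinct extreme points of [polygon], whose facets are
   exactly the v segments [edge i].  *)
Definition ccw_convex : Prop :=
  (2 < v)%N /\
  forall i j : 'I_v, j != i -> j != ordS i ->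
    0 < cross (p (ordS i) - p i) (p j - p i).

Definition tangent_to_edge (c : point) (r : R) (i : 'I_v) : Prop :=
  exists x, circle c r `&` edge_line i = [set x] /\ edge i x.

Definition incircle (c : point) (r : R) : Prop :=
  [/\ 0 < r, disc c r `<=` polygon & forall i, tangent_to_edge c r i].

Definition incenter (c : point) : Prop := exists r, incircle c r.

(* Membership of [polygon] in P_2^in. *)
Definition inscribable_about_origin : Prop :=
  [/\ ccw_convex, interior polygon 0 & exists c, incenter c].

(* Equilateral and equiangular. *)
Definition regular : Prop :=
  (forall i j, edge_length i = edge_length j) /\
  (forall i j, angle (p (ord_pred i)) (p i) (p (ordS i)) =
               angle (p (ord_pred j)) (p j) (p (ordS j))).

Definition S_phi (phi : R -> R) : R :=
  \sum_i phi (dist_to 0 (edge_line i)) * edge_length i.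

End Polygon.

(* Functions (0, oo) -> (0, oo) are represented by total functions whose values
   outside (0, oo) are irrelevant. *)
Definition positive_on_pos (phi : R -> R) : Prop := forall x, 0 < x -> 0 < phi x.

Definition concave_on_pos (phi : R -> R) : Prop :=
  convex_function (`]0, +oo[%classic : set R^o) (fun x => - phi x).

Definition increasing_on_pos (phi : R -> R) : Prop :=
  forall x y, 0 < x -> x <= y -> phi x <= phi y.

(* When phi is affine near the inradius of a regular polygon, small translations
   of the polygon leave S_phi unchanged, so equality in the upper bound for S_phi
   cannot locate the incenter. *)
Definition affine_near (phi : R -> R) (x : R) : Prop :=
  exists a b : R, \forall t \near x, phi t = a * t + b.

End Plane.

(* Main.v *)
Require Import Defs.
From mathcomp Require Import all_boot all_order all_algebra.
From mathcomp Require Import all_classical all_reals all_analysis.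
From mathcomp Require Import zify ring lra.

Set Implicit Arguments.
Unset Strict Implicit.
Unset Printing Implicit Defensive.

Import Order.TTheory GRing.Theory Num.Theory.
Import numFieldNormedType.Exports.

Local Open Scope classical_set_scope.
Local Open Scope ring_scope.

(** Write l_i for the edge lengths, L for the perimeter, h_i for the distances
    from the origin to the edge lines, r for the inradius, rho for the
    circumradius, u_i for the unit edge directions and e_i for the exterior
    angle between u_(i-1) and u_i.

    Cutting the polygon into triangles based on its edges, with apex at the
    origin or at the incenter, computes twice its area in two ways:
    sum_i l_i h_i = r L ([sum_heights]).  Jensen's inequality for the concave phi
    with weights l_i then gives S_phi <= L phi(r) ([S_phi_le]).  As phi is
    increasing and positive, it is enough to bound L and r separately.

    - Since L = sum_i <u_(i-1) - u_i, p_i - z> for every point z and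
      |u_(i-1) - u_i| = 2 sin(e_i / 2), a polygon inside a disc of radius rho
      has L <= 2 rho sum_i sin(e_i / 2) ([perimeter_le_half_ext_angles]).  The
      exterior angles add up to 2 pi ([sum_ext_angle]), so concavity of the sine
      gives L <= 2 v rho sin(pi / v), with equality only for equal angles.
    - The two tangent segments at p_i have length r tan(e_i / 2), hence
      L = 2 r sum_i tan(e_i / 2) >= 2 r v tan(pi / v) by convexity of the
      tangent ([perimeter_incircle]).  Compared with the previous bound this
      gives r <= rho cos(pi / v) ([inradius_le]).

    In the equality case the exterior angles agree, and then so do the edge
    lengths, being sums of two tangent lengths.  Moreover r = rho cos(pi / v)
    and Jensen's inequality for phi is an equality, so that, unless phi is
    affine near r, all h_i are equal to r and the origin is the incenter.
    Conversely a regular polygon with incenter at the origin has h_i = r for all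
    i and turns every inequality above into an equality. *)

(** * Tangent lines and Jensen's inequality *)

Section Jensen.
Variable R : realType.
Implicit Types (f : R -> R) (x y z t m k : R).

Lemma sum_eq_of_le (I : finType) (a b : I -> R) :
  (forall i, a i <= b i) -> \sum_i a i = \sum_i b i -> forall i, a i = b i.
Proof.
move=> ab eab i; apply/eqP; rewrite eq_sym -subr_eq0; apply/eqP.
apply: (@psumr_eq0P R I xpredT (fun i => b i - a i)) => //.
- by move=> j _; rewrite subr_ge0.
- by rewrite sumrB eab subrr.
Qed.

(** Jensen's inequality only needs an affine majorant touching [f] at the weighted
    mean [m]; the same statement serves [phi], the sine and minus the tangent, and
    its equality clause locates the [x i] on the contact set of that majorant. *)
Lemma tangent_jensen (I : finType) (w x : I -> R) f m k :
  (forall i, 0 < w i) -> \sum_i w i * x i = (\sum_i w i) * m ->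
  (forall i, f (x i) <= f m + k * (x i - m)) ->
  \sum_i w i * f (x i) <= (\sum_i w i) * f m /\
  (\sum_i w i * f (x i) = (\sum_i w i) * f m ->
   forall i, f (x i) = f m + k * (x i - m)).
Proof.
move=> w0 xm fk.
have wf i : w i * f (x i) <= w i * (f m + k * (x i - m)).
  by rewrite ler_wpM2l // ltW.
have E : \sum_i w i * (f m + k * (x i - m)) = (\sum_i w i) * f m.
  transitivity (\sum_i (w i * f m + k * (w i * x i - w i * m))).
    by apply: eq_bigr => i _; ring.
  by rewrite big_split/= -mulr_sumr -mulr_suml sumrB xm -mulr_suml subrr mulr0 addr0.
split; first by rewrite -E; apply: ler_sum => i _.
rewrite -E => /(sum_eq_of_le wf) e i.
by apply: (mulfI (lt0r_neq0 (w0 i))).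
Qed.

Lemma sin_lt_tangent x m : 0 <= x <= pi -> 0 <= m <= pi -> x != m ->
  sin x < sin m + cos m * (x - m).
Proof.
move=> /andP[x0 xpi] /andP[m0 mpi].
have mvt a b : a < b ->
    exists2 c, c \in `]a, b[ & sin b - sin a = cos c * (b - a) :> R.
  move=> ab; apply: MVT => //.
  by apply: continuous_subspaceT => y; exact: continuous_sin.
rewrite neq_lt => /orP[xm|mx].
- have [c] := mvt _ _ xm; rewrite in_itv/= => /andP[xc cm] E.
  have : cos m < cos c by rewrite ltr_cos // in_itv/=; apply/andP; split; lra.
  move=> H; nra.
- have [c] := mvt _ _ mx; rewrite in_itv/= => /andP[mc cx] E.
  have : cos c < cos m by rewrite ltr_cos // in_itv/=; apply/andP; split; lra.
  move=> H; nra.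
Qed.

Lemma tan_ge_tangent x m : 0 < x < pi / 2 -> 0 < m < pi / 2 ->
  tan m + (cos m)^-2 * (x - m) <= tan x.
Proof.
move=> /andP[x0 xpi] /andP[m0 mpi].
have cos0 y : 0 < y < pi / 2 -> 0 < cos y :> R.
  by move=> /andP[y0 y1]; apply: cos_gt0_pihalf; rewrite y1 andbT; lra.
have mvt a b : 0 < a -> b < pi / 2 -> a < b ->
    exists2 c, c \in `]a, b[ & tan b - tan a = (cos c)^-2 * (b - a) :> R.
  move=> a0 b1 ab; apply: MVT => // [y|].
    rewrite in_itv/= => /andP[ay yb]; apply: is_derive_tan.
    by rewrite gt_eqF // cos0 //; apply/andP; split; lra.
  apply: continuous_in_subspaceT => y; rewrite inE/= in_itv/= => /andP[ay yb].
  by apply: continuous_tan; rewrite gt_eqF // cos0 //; apply/andP; split; lra.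
have mono a b : 0 < a -> b < pi / 2 -> a < b -> (cos a)^-2 <= (cos b)^-2 :> R.
  move=> a0 b1 ab.
  have ca : 0 < cos a by rewrite cos0//; apply/andP; split; lra.
  have cb : 0 < cos b by rewrite cos0//; apply/andP; split; lra.
  rewrite lef_pV2 ?posrE ?exprn_gt0 //; rewrite ler_pXn2r ?nnegrE ?ltW //.
  by rewrite ltr_cos // in_itv/=; apply/andP; split; lra.
have [xm|mx|->] := ltgtP x m; last by rewrite subrr mulr0 addr0.
- have [c] := mvt _ _ x0 mpi xm; rewrite in_itv/= => /andP[xc cm] E.
  have H := mono _ _ (lt_trans x0 xc) mpi cm; nra.
- have [c] := mvt _ _ m0 xpi mx; rewrite in_itv/= => /andP[mc cx] E.
  have H := mono _ _ m0 (lt_trans cx xpi) mc; nra.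
Qed.

Lemma concave_on_posE f x y t : concave_on_pos f -> 0 < x -> 0 < y ->
  0 <= t <= 1 -> t * f x + (1 - t) * f y <= f (t * x + (1 - t) * y).
Proof.
move=> cf x0 y0 /andP[t0 t1].
have := cf (Itv01 t0 t1) x y; rewrite !inE/= !in_itv/= x0 y0 => /(_ isT isT).
move=> H; have : - f (t * x + (1 - t) * y) <= t * - f x + (1 - t) * - f y := H.
by rewrite lerNl opprD -!mulrN !opprK.
Qed.

(** Cleared denominators allow the degenerate cases [x = y] and [y = z]. *)
Lemma concave_chord f x y z : concave_on_pos f -> 0 < x -> x <= y -> y <= z ->
  (z - y) * f x + (y - x) * f z <= (z - x) * f y.
Proof.
move=> cf x0 xy yz.
have [xz|] := ltP x z; last first.
  move=> zx; have [-> ->] : y = x /\ z = x by split; lra.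
  lra.
have d : 0 < z - x by lra.
have nd : z - x != 0 by rewrite gt_eqF.
have t01 : 0 <= (z - y) / (z - x) <= 1.
  by rewrite divr_ge0 ?ler_pdivrMr //; lra.
have := concave_on_posE cf x0 (lt_trans x0 xz) t01.
have -> : (z - y) / (z - x) * x + (1 - (z - y) / (z - x)) * z = y by field.
rewrite -(ler_pM2l d).
by have -> : (z - x) * ((z - y) / (z - x) * f x + (1 - (z - y) / (z - x)) * f z)
  = (z - y) * f x + (y - x) * f z by field.
Qed.

(** As [f] may have a corner at [m], the slope is the supremum of the chord slopes to
    the right of [m], which the chord slopes to the left of [m] bound above. *)
Lemma concave_tangent f m : concave_on_pos f -> 0 < m ->
  exists k, forall x, 0 < x -> f x <= f m + k * (x - m).
Proof.
move=> cf m0.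
pose S := [set s | exists2 x, m < x & s = (f x - f m) / (x - m)].
have Sub y : 0 < y < m -> ubound S ((f m - f y) / (m - y)).
  move=> /andP[y0 ym] _ [x mx ->].
  rewrite ler_pdivrMr ?subr_gt0 // mulrAC ler_pdivlMr ?subr_gt0 //.
  have := concave_chord cf y0 (ltW ym) (ltW mx); lra.
have S0 : S !=set0 by exists ((f (m + 1) - f m) / (m + 1 - m)), (m + 1) => //; lra.
exists (sup S) => x x0; have [xm|mx|->] := ltgtP x m; last lra.
- have /(ge_sup S0) : ubound S ((f m - f x) / (m - x)) by apply: Sub; rewrite x0.
  rewrite ler_pdivlMr ?subr_gt0 //; lra.
- have : (f x - f m) / (x - m) <= sup S.
    apply: ub_le_sup; last by exists x.
    by exists ((f m - f (m / 2)) / (m - m / 2)); apply: Sub; lra.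
  rewrite ler_pdivrMr ?subr_gt0 //; lra.
Qed.

(** If the [x i] are not all equal to their mean [m], two of them lie on either side of
    [m].  Equality puts both on the tangent line at [m], and a concave function that
    meets a majorizing line at two points coincides with it between them. *)
Lemma concave_jensen (I : finType) (w x : I -> R) f m : concave_on_pos f ->
  0 < m -> (forall i, 0 < w i) -> (forall i, 0 < x i) ->
  \sum_i w i * x i = (\sum_i w i) * m ->
  \sum_i w i * f (x i) <= (\sum_i w i) * f m /\
  (~ affine_near f m -> \sum_i w i * f (x i) = (\sum_i w i) * f m ->
   forall i, x i = m).
Proof.
move=> cf m0 w0 x0 wx; have [k fk] := concave_tangent cf m0.
have [le eq] := tangent_jensen w0 wx (fun i => fk _ (x0 i)).
split=> // naff /eq{le} tang.
have side : ~ (exists i j, x i < m < x j).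
  (* Between x i and x j the graph lies above the chord, which is the tangent line. *)
  move=> [i [j /andP[im mj]]]; apply: naff; exists k, (f m - k * m).
  near=> t.
  have it : x i < t by near: t; exact: lt_nbhsr.
  have tj : t < x j by near: t; exact: lt_nbhsl.
  have t0 : 0 < t := lt_trans (x0 i) it.
  apply/eqP; rewrite eq_le; apply/andP; split; first by have := fk _ t0; lra.
  have := concave_chord cf (x0 i) (ltW it) (ltW tj).
  rewrite (tang i) (tang j) => H.
  have d : 0 < x j - x i by lra.
  rewrite -(ler_pM2l d); nra.
have [ge|] := pselect (forall i, m <= x i).
  move=> i; apply/esym.
  have wl j : w j * m <= w j * x j by rewrite ler_wpM2l ?ge ?(ltW (w0 j)).
  have /(sum_eq_of_le wl) : \sum_i w i * m = \sum_i w i * x i.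
    by rewrite wx mulr_suml.
  by move=> /(_ i) /(mulfI (lt0r_neq0 (w0 i))).
move=> /existsNP[i0 /negP]; rewrite -ltNge => xi0.
have le i : x i <= m.
  by rewrite leNgt; apply/negP => mx; apply: side; exists i0, i; rewrite xi0.
have wl j : w j * x j <= w j * m by rewrite ler_wpM2l ?le ?(ltW (w0 j)).
have /(sum_eq_of_le wl) : \sum_i w i * x i = \sum_i w i * m.
  by rewrite wx mulr_suml.
by move=> E i; apply: (mulfI (lt0r_neq0 (w0 i))).
Unshelve. all: by end_near.
Qed.

End Jensen.

(** * Euclidean geometry of the plane *)

Section Plane.
Variable R : realType.
Notation point := 'rV[R]_2.
Implicit Types (a b x y z : point).

Lemma dotE x y : dot x y = x 0 0 * y 0 0 + x 0 1 * y 0 1.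
Proof.
by rewrite /dot !big_ord_recl big_ord0 addr0; do 2 f_equal; congr (_ 0 _);
  apply/val_inj.
Qed.

Lemma point_eq x y : x 0 0 = y 0 0 -> x 0 1 = y 0 1 -> x = y.
Proof.
move=> e0 e1; apply/rowP => -[[|[|//]] i].
- by rewrite (_ : Ordinal i = 0) //; exact/val_inj.
- by rewrite (_ : Ordinal i = 1) //; exact/val_inj.
Qed.

Lemma dot_ge0 x : 0 <= dot x x.
Proof. by rewrite dotE; nra. Qed.

Lemma dot_eq0 x : dot x x = 0 -> x = 0.
Proof.
rewrite dotE => h.
by apply: point_eq; rewrite mxE; nra.
Qed.

Lemma eudist_ge0 x y : 0 <= eudist x y.
Proof. exact: sqrtr_ge0. Qed.

Lemma sqr_eudist x y : eudist x y ^+ 2 = dot (x - y) (x - y).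
Proof. by rewrite sqr_sqrtr // dot_ge0. Qed.

Lemma eudistC x y : eudist x y = eudist y x.
Proof. by rewrite /eudist !dotE !mxE; congr Num.sqrt; ring. Qed.

Lemma dotBr a x y : dot a (x - y) = dot a x - dot a y.
Proof. by rewrite !dotE !mxE; ring. Qed.

Lemma dotBl a x y : dot (x - y) a = dot x a - dot y a.
Proof. by rewrite !dotE !mxE; ring. Qed.

Lemma crossBr a x y : cross a (x - y) = cross a x - cross a y.
Proof. by rewrite /cross !mxE; ring. Qed.

Lemma crossDr a x y : cross a (x + y) = cross a x + cross a y.
Proof. by rewrite /cross !mxE; ring. Qed.

Lemma crossZr a k x : cross a (k *: x) = k * cross a x.
Proof. by rewrite /cross !mxE; ring. Qed.

Lemma crossZl a k x : cross (k *: a) x = k * cross a x.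
Proof. by rewrite /cross !mxE; ring. Qed.

Lemma dotZl a k x : dot (k *: a) x = k * dot a x.
Proof. by rewrite !dotE !mxE; ring. Qed.

Lemma dotZr a k x : dot a (k *: x) = k * dot a x.
Proof. by rewrite !dotE !mxE; ring. Qed.

Lemma crossxx a : cross a a = 0.
Proof. by rewrite /cross; ring. Qed.

Lemma crossC a b : cross b a = - cross a b.
Proof. by rewrite /cross; ring. Qed.

Lemma cross_sum (I : finType) a (F : I -> point) :
  cross a (\sum_i F i) = \sum_i cross a (F i).
Proof.
apply: (big_morph (cross a) (crossDr a)).
by rewrite /cross !mxE; ring.
Qed.

(** Cramer's rule: the coordinates of [x] on the basis [a], [b]. *)
Lemma cross_expand a b x : cross a b *: x = cross a x *: b - cross b x *: a.
Proof. by apply: point_eq; rewrite /cross !mxE; ring. Qed.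

Lemma dot2_cross2 a b :
  dot a b ^+ 2 + cross a b ^+ 2 = dot a a * dot b b.
Proof. by rewrite !dotE /cross; ring. Qed.

(** Cauchy-Schwarz. *)
Lemma dot_le a b r s : 0 <= r -> 0 <= s ->
  dot a a <= r ^+ 2 -> dot b b <= s ^+ 2 -> dot a b <= r * s.
Proof.
move=> r0 s0 ar bs.
have [?|ab0] := leP (dot a b) 0; first by apply: le_trans (mulr_ge0 r0 s0).
rewrite -(@ler_pXn2r _ 2) ?nnegrE ?mulr_ge0 ?(ltW ab0) //.
rewrite exprMn; apply: le_trans (ler_pM (dot_ge0 a) (dot_ge0 b) ar bs).
by rewrite -dot2_cross2 lerDl sqr_ge0.
Qed.

Lemma exists_angle (x y : R) : x ^+ 2 + y ^+ 2 = 1 ->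
  exists t, [/\ 0 <= t < pi *+ 2, cos t = x & sin t = y].
Proof.
move=> xy.
have x1 : -1 <= x <= 1 by apply/andP; split; nra.
have sa : sin (acos x) = `|y|.
  by rewrite sin_acos // -sqrtr_sqr; congr Num.sqrt; lra.
have pi0 := pi_gt0 R.
have [y0|y0] := leP 0 y.
  exists (acos x); rewrite acosK // sa ger0_norm //; split=> //.
  by rewrite acos_ge0 //=; have := acos_lepi x1; rewrite mulr2n; lra.
exists (pi *+ 2 - acos x); rewrite cosB sinB cos2pi sin2pi acosK // sa.
rewrite ltr0_norm //; split; [|ring|ring].
have := acos_lepi x1; have := acos_ge0 x1; rewrite mulr2n.
suff : acos x != 0 by rewrite neq_lt => /orP[]; lra.
apply/eqP => a0; move: sa; rewrite a0 sin0 ltr0_norm // ; lra.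
Qed.

Lemma sin_lt0_pi (t : R) : pi < t < pi *+ 2 -> sin t < 0.
Proof.
rewrite mulr2n => /andP[t1 t2].
have -> : sin t = - sin (t - pi) by rewrite sinB sinpi cospi; ring.
by rewrite oppr_lt0 sin_gt0_pi // ; apply/andP; split; lra.
Qed.

Lemma sin_gt0_lt_pi (t : R) : 0 <= t < pi *+ 2 -> 0 < sin t -> 0 < t < pi.
Proof.
move=> /andP[t0 t2] s0.
rewrite !lt_neqAle t0 andbT; apply/and3P; split.
- by apply/eqP => e; move: s0; rewrite -e sin0 ltxx.
- by apply/eqP => e; move: s0; rewrite e sinpi ltxx.
- by rewrite leNgt; apply/negP => h; have := @sin_lt0_pi t; rewrite h t2; lra.
Qed.

End Plane.

(** * Exterior angles of a convex polygon *)

Section Polygon.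
Variables (R : realType) (v : nat) (p : 'I_v -> 'rV[R]_2).
Notation point := 'rV[R]_2.
Implicit Types (i j : 'I_v) (x c : point).

Lemma ordS_neq i : (1 < v)%N -> ordS i != i.
Proof.
case: i => i iv v1; rewrite -val_eqE /=.
have [lt|ge] := ltnP i.+1 v; first by rewrite modn_small // gtn_eqF.
have -> : i.+1 = v by apply/eqP; rewrite eqn_leq iv ge.
by rewrite modnn; apply/eqP; lia.
Qed.

Lemma ordSS_neq i : (2 < v)%N -> ordS (ordS i) != i.
Proof.
case: i => i iv v2; rewrite -val_eqE /=; apply/eqP.
have [lt|ge] := ltnP i.+1 v.
  rewrite (modn_small lt); have [lt2|ge2] := ltnP i.+2 v.
    by rewrite modn_small //; lia.
  have -> : i.+2 = v by lia.
  by rewrite modnn; lia.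
have -> : i.+1 = v by lia.
by rewrite modnn modn_small; lia.
Qed.

Lemma sum_ordS (F : 'I_v -> R) : \sum_i F (ordS i) = \sum_i F i.
Proof. by rewrite [RHS](reindex _ (onW_bij _ (ordS_bij v))). Qed.

Definition dir i : point := (edge_length p i)^-1 *: (p (ordS i) - p i).

Definition ext_angle i : R := acos (dot (dir (ord_pred i)) (dir i)).

Hypothesis cc : ccw_convex p.

Let v2 : (2 < v)%N. Proof. by case: cc. Qed.

Lemma edge_length_gt0 i : 0 < edge_length p i.
Proof.
rewrite lt_neqAle eudist_ge0 andbT; apply/eqP => e.
have : dot (p i - p (ordS i)) (p i - p (ordS i)) = 0.
  by rewrite -sqr_eudist; rewrite /edge_length in e; rewrite -e expr0n.
move=> /dot_eq0/eqP; rewrite subr_eq0 => /eqP pe.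
have [_ /(_ i (ordS (ordS i)) (ordSS_neq _ v2))] := cc.
rewrite ordS_neq; last exact: ltnW.
by move=> /(_ isT); rewrite -pe subrr /cross !mxE !mul0r subrr ltxx.
Qed.

Lemma edgeE i : p (ordS i) - p i = edge_length p i *: dir i.
Proof.
by rewrite /dir scalerA mulfV ?scale1r // gt_eqF // edge_length_gt0.
Qed.

Lemma dot_dir i : dot (dir i) (dir i) = 1.
Proof.
rewrite /dir dotZl dotZr -sqr_eudist eudistC -/(edge_length p i).
by have /lt0r_neq0 l := edge_length_gt0 i; field.
Qed.

Lemma edge_lengthE i : edge_length p i = dot (dir i) (p (ordS i) - p i).
Proof. by rewrite edgeE dotZr dot_dir mulr1. Qed.

Lemma cross_dir_start i x :
  cross (dir i) (x - p (ordS i)) = cross (dir i) (x - p i).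
Proof.
have -> : x - p i = (x - p (ordS i)) + (p (ordS i) - p i) by rewrite subrKA.
by rewrite [in RHS]crossDr edgeE crossZr crossxx mulr0 addr0.
Qed.

Lemma cross_dir_gt0 i j : j != i -> j != ordS i ->
  0 < cross (dir i) (p j - p i).
Proof.
move=> ji jSi; rewrite /dir crossZl mulr_gt0 ?invr_gt0 ?edge_length_gt0 //.
by case: cc => _; apply.
Qed.

Lemma cross_dir_ge0 i j : 0 <= cross (dir i) (p j - p i).
Proof.
have [->|ji] := eqVneq j i; first by rewrite subrr /cross !mxE; lra.
have [->|jSi] := eqVneq j (ordS i); first by rewrite edgeE crossZr crossxx mulr0.
exact/ltW/cross_dir_gt0.
Qed.

Lemma cross_dirS i : 0 < cross (dir i) (dir (ordS i)).
Proof.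
rewrite [X in cross _ X]/dir crossZr mulr_gt0 ?invr_gt0 ?edge_length_gt0 //.
by rewrite cross_dir_start cross_dir_gt0 ?ordSS_neq ?ordS_neq // ltnW.
Qed.

Lemma dot_dir_itv i j : -1 <= dot (dir i) (dir j) <= 1.
Proof.
have := dot2_cross2 (dir i) (dir j); rewrite !dot_dir mulr1 => e.
have := sqr_ge0 (cross (dir i) (dir j)); move=> h.
by apply/andP; split; nra.
Qed.

Lemma cos_ext_angle i : cos (ext_angle (ordS i)) = dot (dir i) (dir (ordS i)).
Proof. by rewrite /ext_angle ordSK acosK // in_itv/= dot_dir_itv. Qed.

(** The cosine only determines the absolute value of the cross product, which is
    positive because the polygon turns left at every vertex. *)
Lemma sin_ext_angle i : sin (ext_angle (ordS i)) = cross (dir i) (dir (ordS i)).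
Proof.
rewrite /ext_angle ordSK sin_acos ?dot_dir_itv //.
have := dot2_cross2 (dir i) (dir (ordS i)); rewrite !dot_dir mulr1 => e.
have -> : 1 - dot (dir i) (dir (ordS i)) ^+ 2
        = cross (dir i) (dir (ordS i)) ^+ 2 by lra.
by rewrite sqrtr_sqr gtr0_norm // cross_dirS.
Qed.

Lemma ext_angle_itv i : 0 < ext_angle i < pi.
Proof.
rewrite -[i]ord_predK; set j := ord_pred i.
apply: sin_gt0_lt_pi; last by rewrite sin_ext_angle cross_dirS.
rewrite /ext_angle ordSK acos_ge0 ?dot_dir_itv //=.
have := acos_lepi (dot_dir_itv j (ordS j)); have := pi_gt0 R.
by rewrite mulr2n; lra.
Qed.

Lemma ext_angle_uniq i (t : R) : 0 <= t <= pi ->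
  cos t = dot (dir (ord_pred i)) (dir i) -> ext_angle i = t.
Proof. by move=> t0 e; rewrite /ext_angle -e cosK. Qed.

End Polygon.

(** [al] measures the edge directions from that of edge 0, in [0, 2 pi).  The
    increment of [al] along an edge agrees with the exterior angle up to 2 pi, so it
    could only fail to be that angle by passing from [al i > pi] to
    [al (ordS i) < pi].  Then the height above edge 0 stops decreasing at
    [p (ordS i)], which by convexity makes that vertex a lowest one; but the lowest
    vertices are the ends of edge 0. *)
Lemma ext_angle_is_increment (R : realType) (n : nat) (p : 'I_n.+1 -> 'rV[R]_2)
    (al : 'I_n.+1 -> R) : ccw_convex p ->
  (forall i, [/\ 0 <= al i < pi *+ 2, cos (al i) = dot (dir p ord0) (dir p i)
     & sin (al i) = cross (dir p ord0) (dir p i)]) ->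
  forall i, ordS i != ord0 -> ext_angle p (ordS i) = al (ordS i) - al i.
Proof.
move=> cc H i Si0.
have pi0 := pi_gt0 R.
have [/andP[a0 a2] ca sa] := H i; have [/andP[b0 b2] cb sb] := H (ordS i).
rewrite mulr2n in a2 b2.
have sinab : sin (al (ordS i) - al i) = cross (dir p i) (dir p (ordS i)).
  rewrite sinB ca cb sa sb -[RHS]mul1r -(dot_dir cc ord0) !dotE /cross; ring.
have cosab : cos (al (ordS i) - al i) = dot (dir p i) (dir p (ordS i)).
  rewrite cosB ca cb sa sb -[RHS]mul1r -(dot_dir cc ord0) !dotE /cross; ring.
have sab : 0 < sin (al (ordS i) - al i) by rewrite sinab cross_dirS.
suff lt : al i <= al (ordS i).
  apply: ext_angle_uniq; last by rewrite ordSK.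
  have /andP[]: 0 < al (ordS i) - al i < pi.
    by apply: sin_gt0_lt_pi => //; rewrite mulr2n; lra.
  by move=> h1 h2; rewrite !ltW.
rewrite leNgt; apply/negP => ba.
have h : pi < al i - al (ordS i).
  rewrite ltNge; apply/negP => h.
  have := @sin_ge0_pi R (al i - al (ordS i)).
  by rewrite h -opprB sinN; lra.
have sai : cross (dir p ord0) (dir p i) < 0.
  by rewrite -sa; apply: sin_lt0_pi; rewrite mulr2n; lra.
have sbi : 0 <= cross (dir p ord0) (dir p (ordS i)).
  by rewrite -sb; apply: sin_ge0_pi; lra.
have i0 : i != ord0.
  by apply/eqP => e; move: sai; rewrite e crossxx ltxx.
(* The polygon lies in the cone at p (ordS i) spanned by the reversed incoming
   edge and the outgoing edge; p ord0, which is strictly lower, does not. *)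
set w := p ord0 - p (ordS i).
have aw : 0 <= cross (dir p i) w by rewrite cross_dir_start // cross_dir_ge0.
have bw : 0 <= cross (dir p (ordS i)) w by exact: cross_dir_ge0.
have uw : cross (dir p ord0) w < 0.
  have -> : cross (dir p ord0) w = - cross (dir p ord0) (p (ordS i) - p ord0).
    by rewrite /w /cross !mxE; ring.
  rewrite oppr_lt0 cross_dir_gt0 //.
  by apply: contra_neq i0 => /(can_inj (@ordSK _)).
have E : cross (dir p i) (dir p (ordS i)) * cross (dir p ord0) w
   = - cross (dir p (ordS i)) w * cross (dir p ord0) (dir p i)
     + cross (dir p i) w * cross (dir p ord0) (dir p (ordS i)).
  by rewrite /cross; ring.
have c0 := cross_dirS cc i; clear - aw bw uw E c0 sai sbi; nra.
Qed.

(** The exterior angles telescope along the angles of the edge directions; the exterior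
    angle at vertex 0 closes the full turn. *)
Lemma sum_ext_angle (R : realType) (v : nat) (p : 'I_v -> 'rV[R]_2) :
  ccw_convex p -> \sum_i ext_angle p i = pi *+ 2.
Proof.
case: v p => [|n] p cc; first by case: cc.
have /choice[al H] : forall i, exists t, [/\ 0 <= t < pi *+ 2,
    cos t = dot (dir p ord0) (dir p i) & sin t = cross (dir p ord0) (dir p i)].
  move=> i; apply: exists_angle.
  by rewrite dot2_cross2 !dot_dir // mulr1.
have step := ext_angle_is_increment cc H.
have pi0 := pi_gt0 R.
have al0 : al ord0 = 0.
  have [/andP[a0 a2] _] := H ord0; rewrite crossxx => s0.
  apply/eqP; rewrite eq_le a0 andbT leNgt; apply/negP => apos.
  have [lt|gt|eq] := ltgtP (al ord0) pi.
  - by have := @sin_gt0_pi R (al ord0); rewrite apos lt s0 ltxx => /(_ isT).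
  - by have := @sin_lt0_pi R (al ord0); rewrite gt a2 s0 ltxx => /(_ isT).
  - by have [_] := H ord0; rewrite eq cospi dot_dir //; lra.
have Smax : ordS (@ord_max n) = ord0 by apply/val_inj => /=; rewrite modnn.
have last : ext_angle p ord0 = pi *+ 2 - al ord_max.
  have [/andP[a0 a2] ca sa] := H ord_max.
  have c0 := cross_dirS cc ord_max; rewrite Smax crossC -sa oppr_gt0 in c0.
  have api : pi < al ord_max.
    rewrite ltNge; apply/negP => h.
    by have := @sin_ge0_pi R (al ord_max); rewrite a0 h; lra.
  apply: ext_angle_uniq; first by move: a2; rewrite mulr2n; lra.
  have -> : ord_pred ord0 = @ord_max n by rewrite -Smax ordSK.
  rewrite cosB cos2pi sin2pi ca !dotE; ring.
rewrite big_ord_recl last.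
pose A k := al (inord k).
rewrite (eq_bigr (fun i : 'I_n => A i.+1 - A i)); last first.
  move=> i _.
  have iE : lift ord0 i = ordS (inord i).
    apply/val_inj; rewrite /= inordK; last exact/leqW/ltn_ord.
    by rewrite modn_small // ltnS.
  rewrite iE step -?iE //; congr (al _ - _).
  by apply/val_inj; rewrite /= inordK // ltnS.
rewrite -(big_mkord xpredT (fun k => A k.+1 - A k)) telescope_sumr //.
rewrite /A (_ : inord 0 = ord0) ?al0; last by apply/val_inj; rewrite /= inordK.
rewrite (_ : inord n = ord_max); last by apply/val_inj; rewrite /= inordK.
ring.
Qed.

(** * The incircle and the circumradius *)

Section Incircle.
Variables (R : realType) (v : nat) (p : 'I_v -> 'rV[R]_2).
Notation point := 'rV[R]_2.
Implicit Types (i j : 'I_v) (x c : point) (r : R).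

Lemma vertex_in_polygon i : polygon p (p i).
Proof.
exists (fun j => (j == i)%:R); split.
- by move=> j; exact: ler0n.
- by rewrite (bigD1 i) //= eqxx big1 ?addr0 // => j /negbTE ->.
- rewrite (bigD1 i) //= eqxx scale1r big1 ?addr0 // => j /negbTE ->.
  by rewrite scale0r.
Qed.

(** For [x] a convex combination of the vertices, [|c - x|^2] is the same combination of
    the [<c - x, c - p i>], each at most [|c - x| r]. *)
Lemma polygon_sub_disc c r : 0 <= r -> (forall i, eudist c (p i) <= r) ->
  polygon p `<=` disc c r.
Proof.
move=> r0 H x [w [w0 w1 xE]]; rewrite /disc/=.
have E : dot (c - x) (c - x) = \sum_i w i * dot (c - x) (c - p i).
  rewrite [X in dot _ X](_ : _ = \sum_i w i *: (c - p i)); last first.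
    under eq_bigr do rewrite scalerBr.
    by rewrite sumrB -scaler_suml w1 scale1r xE.
  rewrite (big_morph (dot (c - x)) (id1 := 0) (op1 := +%R)).
  - by apply: eq_bigr => i _; rewrite dotZr.
  - by move=> a b; rewrite !dotE !mxE; ring.
  - by rewrite !dotE !mxE; ring.
have : eudist c x ^+ 2 <= eudist c x * r.
  rewrite sqr_eudist E -[leRHS]mul1r -w1 mulr_suml; apply: ler_sum => i _.
  apply: ler_wpM2l => //; apply: dot_le => //; first exact: eudist_ge0.
  - by rewrite sqr_eudist.
  - by rewrite -sqr_eudist ler_pXn2r ?nnegrE ?eudist_ge0.
have := eudist_ge0 c x; rewrite le_eqVlt => /orP[/eqP <- //|d0].
by rewrite expr2 ler_pM2l.
Qed.

Hypothesis cc : ccw_convex p.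

Lemma polygon_left i x : polygon p x -> 0 <= cross (dir p i) (x - p i).
Proof.
move=> [w [w0 w1 ->]].
rewrite [X in cross _ X](_ : _ = \sum_j w j *: (p j - p i)); last first.
  under [RHS]eq_bigr do rewrite scalerBr.
  by rewrite sumrB -scaler_suml w1 scale1r.
rewrite cross_sum; apply: sumr_ge0 => j _.
by rewrite crossZr mulr_ge0 // cross_dir_ge0.
Qed.

Lemma interior_left i x :
  interior (polygon p) x -> 0 < cross (dir p i) (x - p i).
Proof.
move=> /nbhs_ballP[e /= e0 xe].
have left z := @polygon_left i z.
move: (dir p i) (dot_dir cc i) left => u; rewrite dotE => u1 left.
(* A point of the ball around x, moved towards the edge line along its normal. *)
pose y : point := x - \row_k (e / 2 * (if k == 0 then - u 0 1 else u 0 0)).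
have /xe/left : ball x e y.
  split=> // a k; rewrite /ball/= /y !mxE opprD opprK addrA subrr add0r.
  rewrite normrM gtr0_norm ?divr_gt0 //.
  have : `|if k == 0 then - u 0 1 else u 0 0| <= 1.
    by case: ifP => _; rewrite ler_norml; apply/andP; split; nra.
  by move: `|_| => n n1; nra.
rewrite /cross /y !mxE /=; nra.
Qed.

Lemma edge_lineP i x :
  edge_line p i x <-> exists t : R, x = p i + t *: dir p i.
Proof.
have l0 := edge_length_gt0 cc i.
split=> -[t ->].
- exists (t * edge_length p i).
  by rewrite -scalerA -(edgeE cc) scalerBr scalerBl scale1r addrAC addrA.
- exists (t / edge_length p i).
  have -> : p (ordS i) = p i + edge_length p i *: dir p i.
    by rewrite -(edgeE cc) addrC subrK.
  rewrite scalerDr scalerA addrA -scalerDl subrK scale1r divfK //.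
  by rewrite gt_eqF.
Qed.

(** Pythagoras, with the foot of the perpendicular at parameter
    [dot (dir p i) (x - p i)]. *)
Lemma sqr_eudist_line i x (t : R) : eudist x (p i + t *: dir p i) ^+ 2 =
  cross (dir p i) (x - p i) ^+ 2 + (dot (dir p i) (x - p i) - t) ^+ 2.
Proof.
have d1 := dot_dir cc i.
rewrite sqr_eudist.
have -> : (dot (dir p i) (x - p i) - t) ^+ 2 = dot (dir p i) (x - p i) ^+ 2
   - 2 * t * dot (dir p i) (x - p i) + t ^+ 2 by ring.
have -> : dot (x - (p i + t *: dir p i)) (x - (p i + t *: dir p i))
  = dot (x - p i) (x - p i) - 2 * t * dot (dir p i) (x - p i)
     + t ^+ 2 * dot (dir p i) (dir p i).
  by rewrite !dotE !mxE; ring.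
have := dot2_cross2 (dir p i) (x - p i); rewrite d1; lra.
Qed.

Lemma dist_to_edge_line i x : 0 <= cross (dir p i) (x - p i) ->
  dist_to x (edge_line p i) = cross (dir p i) (x - p i).
Proof.
set s := cross _ _ => s0.
have foot : [set eudist x y | y in edge_line p i] s.
  exists (p i + dot (dir p i) (x - p i) *: dir p i); first by apply/edge_lineP; eexists.
  apply/eqP; rewrite -(@eqrXn2 _ 2) ?eudist_ge0 // sqr_eudist_line.
  by rewrite subrr expr0n addr0.
have lb : lbound [set eudist x y | y in edge_line p i] s.
  move=> _ [_ /edge_lineP[t ->] <-].
  rewrite -(@ler_pXn2r _ 2) ?nnegrE ?eudist_ge0 // sqr_eudist_line.
  by rewrite lerDl sqr_ge0.
apply/eqP; rewrite eq_le; apply/andP; split.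
- by apply: ge_inf => //; exists s.
- by apply: lb_le_inf => //; exists s.
Qed.

(** The contact point is its own mirror image in the foot of the perpendicular from [c],
    since the mirror image is also common to the circle and the line; so it is that foot.
    The signed distance is positive because [c] lies in the polygon. *)
Lemma incircle_cross c r i : incircle p c r -> cross (dir p i) (c - p i) = r.
Proof.
move=> [r0 sub tan].
have s0 : 0 <= cross (dir p i) (c - p i).
  apply/polygon_left/sub; rewrite /disc/= /eudist subrr dotE !mxE mul0r addr0.
  by rewrite sqrtr0 ltW.
have [x [E _]] := tan i.
have : (circle c r `&` edge_line p i) x by rewrite E.
move=> [cx /edge_lineP[t xE]].
set s := cross _ _ in s0 *; pose f := dot (dir p i) (c - p i).
have rs : r ^+ 2 = s ^+ 2 + (f - t) ^+ 2.
  by rewrite -cx xE sqr_eudist_line.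
(* The mirror image of the contact point. *)
have : (circle c r `&` edge_line p i) (p i + (2 * f - t) *: dir p i).
  split; last by apply/edge_lineP; eexists.
  apply/eqP; rewrite -(@eqrXn2 _ 2) ?eudist_ge0 ?(ltW r0) //.
  by rewrite sqr_eudist_line rs -/s -/f; apply/eqP; ring.
rewrite E /= xE => /addrI/eqP.
rewrite -subr_eq0 -scalerBl scaler_eq0 => /orP[/eqP ft|/eqP u0]; last first.
  by have := dot_dir cc i; rewrite u0 dotE !mxE; lra.
apply/eqP; rewrite -(@eqrXn2 _ 2) ?(ltW r0) // rs.
have -> : f - t = 0 by lra.
by rewrite expr0n addr0.
Qed.

Definition half_ext_angle i : R := ext_angle p i / 2.

Lemma half_ext_angle_itv i : 0 < half_ext_angle i < pi / 2.
Proof. by have := ext_angle_itv cc i; rewrite /half_ext_angle; lra. Qed.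

Lemma cos_half_ext_angle_gt0 i : 0 < cos (half_ext_angle i).
Proof.
have := half_ext_angle_itv i => /andP[h1 h2].
by apply: cos_gt0_pihalf; rewrite h2 andbT; lra.
Qed.

Lemma sin_half_ext_angle_gt0 i : 0 < sin (half_ext_angle i).
Proof.
have := half_ext_angle_itv i => /andP[h1 h2].
by apply: sin_gt0_pi; rewrite h1; lra.
Qed.

Lemma cos_ext_angle_half i : cos (ext_angle p i) = 1 - 2 * sin (half_ext_angle i) ^+ 2.
Proof.
have -> : ext_angle p i = half_ext_angle i *+ 2.
  by rewrite /half_ext_angle mulr2n; field.
by rewrite cos_mulr2n cos2sin2; ring.
Qed.

Lemma sin_ext_angle_half i :
  sin (ext_angle p i) = 2 * sin (half_ext_angle i) * cos (half_ext_angle i).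
Proof.
have -> : ext_angle p i = half_ext_angle i *+ 2.
  by rewrite /half_ext_angle mulr2n; field.
by rewrite sin_mulr2n; ring.
Qed.

Lemma sum_half_ext_angle : \sum_i half_ext_angle i = v%:R * (pi / v%:R).
Proof.
have v0 : v%:R != 0 :> R by rewrite pnatr_eq0; case: cc; lia.
by rewrite -mulr_suml sum_ext_angle // mulr2n; field.
Qed.

(** The triangle formed by the incenter, a vertex and a contact point next to it has a
    right angle at the contact point and half the exterior angle at the incenter; its
    legs are [r] and the tangent length, its hypotenuse joins incenter and vertex. *)
Lemma incircle_vertex c r i : incircle p c r ->
  [/\ dot (dir p i) (p (ordS i) - c) = r * tan (half_ext_angle (ordS i)),
      dot (dir p (ordS i)) (p (ordS i) - c) = - (r * tan (half_ext_angle (ordS i)))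
    & eudist c (p (ordS i)) = r / cos (half_ext_angle (ordS i))].
Proof.
move=> inc; set a := dir p i; set b := dir p (ordS i); set q := p (ordS i) - c.
have r0 : 0 < r by case: inc.
have aq : cross a q = - r.
  have := incircle_cross i inc; rewrite -(cross_dir_start cc) -/a => <-.
  by rewrite /q /cross !mxE; ring.
have bq : cross b q = - r.
  have := incircle_cross (ordS i) inc; rewrite -/b => <-.
  by rewrite /q /cross !mxE; ring.
have aa : dot a a = 1 := dot_dir cc i.
have bb : dot b b = 1 := dot_dir cc (ordS i).
have co := cos_ext_angle cc i; have si := sin_ext_angle cc i.
rewrite -/a -/b cos_ext_angle_half in co; rewrite -/a -/b sin_ext_angle_half in si.
set h := half_ext_angle (ordS i) in co si *.
have s0 : 0 < sin h := sin_half_ext_angle_gt0 _.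
have c0 : 0 < cos h := cos_half_ext_angle_gt0 _.
have e1 : dot a a * cross b q = dot a b * cross a q - cross a b * dot a q.
  by rewrite !dotE /cross; ring.
have e2 : dot b b * cross a q = dot a b * cross b q + cross a b * dot b q.
  by rewrite !dotE /cross; ring.
rewrite aa bq aq -co -si in e1; rewrite bb bq aq -co -si in e2.
have d1 : dot a q = r * tan h.
  rewrite /tan mulrA; apply: (canRL (mulfK (lt0r_neq0 c0))).
  apply: (mulfI (lt0r_neq0 s0)); lra.
have d2 : dot b q = - (r * tan h).
  rewrite /tan mulrA -mulNr; apply: (canRL (mulfK (lt0r_neq0 c0))).
  apply: (mulfI (lt0r_neq0 s0)); lra.
split=> //.
apply/eqP; rewrite -(@eqrXn2 _ 2) ?eudist_ge0 ?divr_ge0 ?ltW //.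
rewrite eudistC sqr_eudist -/q -[dot q q]mul1r -aa -dot2_cross2 d1 aq.
rewrite expr_div_n; have -> : (r * tan h) ^+ 2 + (- r) ^+ 2 = r ^+ 2 * (1 + tan h ^+ 2).
  by ring.
by rewrite -cos2_tan2 // gt_eqF.
Qed.

Lemma edge_length_incircle c r i : incircle p c r ->
  edge_length p i = r * tan (half_ext_angle (ordS i)) + r * tan (half_ext_angle i).
Proof.
move=> inc; rewrite (edge_lengthE cc).
have [d1 _ _] := incircle_vertex i inc.
have [_ + _] := incircle_vertex (ord_pred i) inc; rewrite ord_predK => d2.
have -> : p (ordS i) - p i = (p (ordS i) - c) - (p i - c).
  by rewrite opprB subrKA.
by rewrite dotBr d1 d2 opprK.
Qed.

Let v0 : (0 < v)%N. Proof. by case: cc; lia. Qed.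

Definition perimeter : R := \sum_i edge_length p i.

Lemma perimeter_incircle c r : incircle p c r ->
  perimeter = r * (2 * \sum_i tan (half_ext_angle i)).
Proof.
move=> inc; rewrite /perimeter.
under eq_bigr do rewrite (edge_length_incircle _ inc).
rewrite big_split/= (sum_ordS (fun i => r * tan (half_ext_angle i))) -!mulr_sumr.
ring.
Qed.

(** Abel summation moves the differences from the vertices to the edge directions, and
    [|u_(i-1) - u_i|] is twice the sine of half the exterior angle. *)
Lemma perimeter_le_half_ext_angles z r : 0 <= r -> polygon p `<=` disc z r ->
  perimeter <= r * (2 * \sum_i sin (half_ext_angle i)).
Proof.
move=> r0 sub.
have -> : perimeter = \sum_i dot (dir p (ord_pred i) - dir p i) (p i - z).
  under eq_bigr do rewrite dotBl.
  rewrite sumrB -(sum_ordS (fun i => dot (dir p (ord_pred i)) (p i - z))) -sumrB.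
  apply: eq_bigr => i _.
  rewrite ordSK (edge_lengthE cc) -dotBr; congr (dot _ _).
  by rewrite opprB subrKA.
rewrite !mulr_sumr; apply: ler_sum => i _; rewrite mulrC.
apply: dot_le => //.
- by rewrite mulr_ge0 // ltW // sin_half_ext_angle_gt0.
- have := cos_ext_angle cc (ord_pred i); rewrite ord_predK cos_ext_angle_half => e.
  have -> : dot (dir p (ord_pred i) - dir p i) (dir p (ord_pred i) - dir p i)
     = dot (dir p (ord_pred i)) (dir p (ord_pred i)) + dot (dir p i) (dir p i)
       - 2 * dot (dir p (ord_pred i)) (dir p i) by rewrite !dotE !mxE; ring.
  rewrite !dot_dir // -e exprMn; lra.
- rewrite -sqr_eudist ler_pXn2r ?nnegrE ?eudist_ge0 // eudistC.
  exact/sub/vertex_in_polygon.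
Qed.

Lemma circumradius_set_neq0 :
  [set r : R | 0 <= r /\ exists c, polygon p `<=` disc c r] !=set0.
Proof.
pose B := \sum_i eudist 0 (p i).
have B0 : 0 <= B by apply: sumr_ge0 => i _; exact: eudist_ge0.
exists B; split=> //; exists 0; apply: polygon_sub_disc => // i.
by rewrite /B (bigD1 i) //= lerDl; apply: sumr_ge0 => j _; exact: eudist_ge0.
Qed.

Lemma circumradius_le c r : 0 <= r -> (forall i, eudist c (p i) <= r) ->
  circumradius (polygon p) <= r.
Proof.
move=> r0 H; apply: ge_inf; first by exists 0 => x [].
by split=> //; exists c; exact: polygon_sub_disc.
Qed.

(** The bound holds for every enclosing disc, hence passes to the infimum of the radii. *)
Lemma perimeter_le_circumradius :
  perimeter <= circumradius (polygon p) * (2 * \sum_i sin (half_ext_angle i)).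
Proof.
have S0 : 0 < 2 * \sum_i sin (half_ext_angle i).
  rewrite mulr_gt0 // (bigD1 (Ordinal v0)) //= ltr_wpDr ?sin_half_ext_angle_gt0 //.
  by apply: sumr_ge0 => i _; rewrite ltW // sin_half_ext_angle_gt0.
rewrite -ler_pdivrMr //; apply: lb_le_inf; first exact: circumradius_set_neq0.
move=> r [r0 [z sub]]; rewrite ler_pdivrMr //.
exact: perimeter_le_half_ext_angles sub.
Qed.

End Incircle.

(** * The extremal problem *)

Section Extremal.
Variables (R : realType) (v : nat) (p : 'I_v -> 'rV[R]_2).
Hypothesis cc : ccw_convex p.
Implicit Types (i j : 'I_v) (c : 'rV[R]_2) (r : R).

Let rho : R := circumradius (polygon p).
Let theta : R := pi / v%:R.

Let v2 : (2 < v)%N. Proof. by case: cc. Qed.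
Let vR0 : 0 < v%:R :> R. Proof. by rewrite ltr0n; lia. Qed.

Lemma theta_itv : 0 < theta < pi / 2.
Proof.
have pi0 := pi_gt0 R; have v2R : 2 < v%:R :> R by rewrite ltr_nat.
rewrite /theta divr_gt0 //= ltr_pdivrMr //; nra.
Qed.

Lemma cos_theta_gt0 : 0 < cos theta.
Proof.
have := theta_itv => /andP[h1 h2].
by apply: cos_gt0_pihalf; rewrite h2 andbT; lra.
Qed.

Lemma sin_theta_gt0 : 0 < sin theta.
Proof.
have := theta_itv => /andP[h1 h2].
by apply: sin_gt0_pi; rewrite h1; lra.
Qed.

(** The mean of the half exterior angles, in the form that Jensen's inequality uses. *)
Let unit_weights : \sum_(i < v) (1 : R) * half_ext_angle p i = (\sum_(i < v) 1) * theta.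
Proof.
under eq_bigr do rewrite mul1r.
by rewrite sum_half_ext_angle // sumr_const card_ord.
Qed.

Lemma sum_sin_half_ext_angle : \sum_i sin (half_ext_angle p i) <= v%:R * sin theta /\
  (\sum_i sin (half_ext_angle p i) = v%:R * sin theta ->
   forall i, half_ext_angle p i = theta).
Proof.
have [h1 h2] : 0 <= theta /\ theta <= pi by have := theta_itv; lra.
have tg i : half_ext_angle p i != theta -> sin (half_ext_angle p i) < sin theta
    + cos theta * (half_ext_angle p i - theta).
  have /andP[? ?] := half_ext_angle_itv cc i.
  by apply: sin_lt_tangent; apply/andP; split; lra.
have [|] := @tangent_jensen R _ (fun=> 1) (half_ext_angle p) sin theta (cos theta)
  (fun=> ltr01) unit_weights.
  move=> i; have [->|/tg/ltW//] := eqVneq (half_ext_angle p i) theta.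
  by rewrite subrr mulr0 addr0.
under eq_bigr do rewrite mul1r.
rewrite sumr_const card_ord => le eq; split=> // /eq{}eq i.
by apply/eqP/negPn/negP => /tg; rewrite eq ltxx.
Qed.

Lemma sum_tan_half_ext_angle : v%:R * tan theta <= \sum_i tan (half_ext_angle p i).
Proof.
have [|le _] := @tangent_jensen R _ (fun=> 1) (half_ext_angle p) (fun x => - tan x)
  theta (- (cos theta)^-2) (fun=> ltr01) unit_weights.
  by move=> i; have := tan_ge_tangent (half_ext_angle_itv cc i) theta_itv; lra.
move: le; under eq_bigr do rewrite mul1r.
by rewrite sumrN sumr_const card_ord mulrN lerN2.
Qed.

Lemma perimeter_gt0 : 0 < perimeter p.
Proof.
have i0 : 'I_v by apply: (@Ordinal v 0); lia.
rewrite /perimeter (bigD1 i0) //= ltr_wpDr ?edge_length_gt0 //.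
by apply: sumr_ge0 => i _; rewrite ltW // edge_length_gt0.
Qed.

Lemma circumradius_gt0 : 0 < rho.
Proof.
have S0 : 0 <= 2 * \sum_i sin (half_ext_angle p i).
  by rewrite mulr_ge0 // sumr_ge0 // => i _; rewrite ltW // sin_half_ext_angle_gt0.
have := lt_le_trans perimeter_gt0 (perimeter_le_circumradius cc).
rewrite ltNge -/rho => h; rewrite ltNge; apply/negP => r0; move/negP: h; apply.
by rewrite mulr_le0_ge0.
Qed.

Lemma perimeter_le : perimeter p <= 2 * v%:R * rho * sin theta.
Proof.
apply: le_trans (perimeter_le_circumradius cc) _; rewrite -/rho.
have [le _] := sum_sin_half_ext_angle; have := circumradius_gt0; nra.
Qed.

Lemma perimeter_extremal : perimeter p = 2 * v%:R * rho * sin theta ->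
  forall i, half_ext_angle p i = theta.
Proof.
move=> e; have [le eq] := sum_sin_half_ext_angle; apply: eq.
apply/eqP; rewrite eq_le le /= -(ler_pM2l circumradius_gt0).
by have := perimeter_le_circumradius cc; rewrite -/rho e; lra.
Qed.

(** The lower bound of the perimeter by the inradius meets its upper bound by the
    circumradius. *)
Lemma inradius_le c r : incircle p c r -> r <= rho * cos theta.
Proof.
move=> inc; have r0 : 0 < r by case: inc.
have /andP[t0 t1] := theta_itv.
have s0 := sin_theta_gt0; have c0 := cos_theta_gt0.
have : r * (2 * (v%:R * tan theta)) <= 2 * v%:R * rho * sin theta.
  apply: le_trans perimeter_le; rewrite (perimeter_incircle cc inc).
  by rewrite ler_pM2l // ler_pM2l // sum_tan_half_ext_angle.
have -> : r * (2 * (v%:R * tan theta)) = (2 * v%:R * sin theta) * (r / cos theta).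
  by rewrite /tan; ring.
have -> : 2 * v%:R * rho * sin theta = (2 * v%:R * sin theta) * rho by ring.
by rewrite ler_pM2l ?mulr_gt0 // ler_pdivrMr.
Qed.

(** All vertices are at distance [r / cos theta] from the incenter, which bounds the
    circumradius from above; [inradius_le] is the opposite bound. *)
Lemma inradius_equiangular c r : incircle p c r ->
  (forall i, half_ext_angle p i = theta) ->
  r = rho * cos theta /\ perimeter p = 2 * v%:R * rho * sin theta.
Proof.
move=> inc ht; have r0 : 0 < r by case: inc.
have c0 := cos_theta_gt0.
have rE : r = rho * cos theta.
  apply/eqP; rewrite eq_le (inradius_le inc) /= -ler_pdivlMr //.
  apply: (@circumradius_le _ _ _ c); first by rewrite divr_ge0 ?ltW.
  move=> i; have [_ _] := incircle_vertex cc (ord_pred i) inc.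
  by rewrite ord_predK ht => ->.
split=> //; rewrite (perimeter_incircle cc inc).
under eq_bigr do rewrite ht.
rewrite sumr_const card_ord rE /tan -mulr_natl.
by have := lt0r_neq0 c0 => ?; field.
Qed.

Lemma angleE i : angle (p (ord_pred i)) (p i) (p (ordS i)) = pi - ext_angle p i.
Proof.
rewrite /angle /ext_angle -acosN ?dot_dir_itv //; congr acos.
rewrite [eudist (p (ordS i)) _]eudistC -/(edge_length p i).
have -> : eudist (p (ord_pred i)) (p i) = edge_length p (ord_pred i).
  by rewrite /edge_length ord_predK.
have := edge_length_gt0 cc i; have := edge_length_gt0 cc (ord_pred i).
move=> /lt0r_neq0 l1 /lt0r_neq0 l2.
have -> : p (ord_pred i) - p i = - 1 *: (p (ordS (ord_pred i)) - p (ord_pred i)).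
  by rewrite ord_predK scaleN1r opprB.
rewrite !(edgeE cc) scalerA !dotZl dotZr; field.
by rewrite l1 l2.
Qed.

Lemma equiangularE : (forall i j, ext_angle p i = ext_angle p j) ->
  forall i, half_ext_angle p i = theta.
Proof.
move=> e i; have := sum_half_ext_angle cc.
rewrite (eq_bigr (fun=> half_ext_angle p i)); last first.
  by move=> j _; rewrite /half_ext_angle (e j i).
rewrite sumr_const card_ord -[_ *+ v]mulr_natl => h.
exact: (mulfI (lt0r_neq0 vR0) h).
Qed.

(** A circumscribed polygon with equal angles has equal edges, since each edge is the
    sum of two tangent lengths. *)
Lemma regularE c r : incircle p c r ->
  regular p <-> forall i, half_ext_angle p i = theta.
Proof.
move=> inc; split=> [[_ ang]|ht].
- apply: equiangularE => i j.
  by have := ang i j; rewrite !angleE => /addrI/oppr_inj.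
- split=> i j; first by rewrite !(edge_length_incircle cc _ inc) !ht.
  rewrite !angleE; congr (_ - _).
  by have := ht i; rewrite -(ht j) /half_ext_angle => /mulIf; apply; rewrite invr_eq0.
Qed.

Lemma sum_edge_vectors : \sum_i edge_length p i *: dir p i = 0.
Proof.
under eq_bigr do rewrite -(edgeE cc).
by rewrite sumrB [X in _ - X](reindex _ (onW_bij _ (ordS_bij v))) subrr.
Qed.

(** Both sides are twice the area; they agree because the edge vectors add up to 0. *)
Lemma sum_heights x y :
  \sum_i edge_length p i * cross (dir p i) (x - p i) =
  \sum_i edge_length p i * cross (dir p i) (y - p i).
Proof.
apply/eqP; rewrite -subr_eq0 -sumrB.
rewrite (eq_bigr (fun i => cross (y - x) (edge_length p i *: dir p i))); last first.
  by move=> i _; rewrite crossZr [cross (y - x) _]crossC !crossBr; ring.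
by rewrite -cross_sum sum_edge_vectors /cross !mxE !mulr0 subrr.
Qed.

(** Two consecutive edges are not parallel, so distances to their lines determine a
    point. *)
Lemma eq_heights x y :
  (forall i, cross (dir p i) (x - p i) = cross (dir p i) (y - p i)) -> x = y.
Proof.
move=> H; have i0 : 'I_v by apply: (@Ordinal v 0); lia.
have h i : cross (dir p i) (x - y) = 0.
  by have := H i; rewrite !crossBr; lra.
have c0 := cross_dirS cc i0.
have := h i0; have := h (ordS i0).
move=> h1 h0; apply/eqP; rewrite -subr_eq0.
have /eqP := cross_expand (dir p i0) (dir p (ordS i0)) (x - y).
by rewrite h0 h1 !scale0r subrr scaler_eq0 gt_eqF.
Qed.

Variable phi : R -> R.
Hypothesis o_in : interior (polygon p) 0.

Lemma S_phiE : S_phi p phi =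
  \sum_i edge_length p i * phi (cross (dir p i) (0 - p i)).
Proof.
apply: eq_bigr => i _; rewrite mulrC dist_to_edge_line //.
exact/ltW/interior_left.
Qed.

Lemma S_phi_le c r : concave_on_pos phi -> incircle p c r ->
  S_phi p phi <= perimeter p * phi r /\
  (~ affine_near phi r -> S_phi p phi = perimeter p * phi r -> c = 0).
Proof.
move=> cphi inc; have r0 : 0 < r by case: inc.
rewrite S_phiE.
have [|||le eq] := @concave_jensen R _ (edge_length p)
    (fun i => cross (dir p i) (0 - p i)) phi r cphi r0.
- by move=> i; exact: edge_length_gt0.
- by move=> i; exact: interior_left.
- rewrite (sum_heights 0 c) mulr_suml; apply: eq_bigr => i _.
  by rewrite (incircle_cross cc _ inc).
split=> // na /(eq na) h; apply: eq_heights => i.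
by rewrite h (incircle_cross cc _ inc).
Qed.

End Extremal.

Theorem corollary5p1 (R : realType) (v : nat) (p : 'I_v -> 'rV[R]_2)
    (phi : R -> R)
    (Q_in : inscribable_about_origin p)
    (phi_pos : positive_on_pos phi)
    (phi_concave : concave_on_pos phi)
    (phi_incr : increasing_on_pos phi) :
  let rho := circumradius (polygon p) in
  let bound := 2 * v%:R * rho * sin (pi / v%:R) * phi (rho * cos (pi / v%:R)) in
  [/\ S_phi p phi <= bound,
      ~ affine_near phi (rho * cos (pi / v%:R)) ->
        (S_phi p phi = bound <-> regular p /\ incenter p 0),
      regular p /\ incenter p 0 -> S_phi p phi = bound
    & S_phi p phi = bound -> regular p].
Proof.
move=> rho bound; case: Q_in => cc o_in [c [r inc]].
have r0 : 0 < r by case: inc.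
have [SL Seq] := S_phi_le cc o_in phi_concave inc.
have L0 := perimeter_gt0 cc.
have le1 : perimeter p * phi r <= perimeter p * phi (rho * cos (pi / v%:R)).
  by rewrite ler_pM2l // phi_incr // (inradius_le cc inc).
have rc0 : 0 < rho * cos (pi / v%:R) := lt_le_trans r0 (inradius_le cc inc).
have phi0 := phi_pos _ rc0.
have le2 : perimeter p * phi (rho * cos (pi / v%:R)) <= bound.
  by rewrite /bound ler_pM2r // perimeter_le.
have extremal : S_phi p phi = bound -> forall i, half_ext_angle p i = pi / v%:R.
  move=> e; apply: perimeter_extremal => //.
  (* S_phi <= L phi(r) <= L phi(rho cos(pi / v)) <= bound collapses, and the positive
     factor phi(rho cos(pi / v)) cancels from the last inequality. *)
  by apply: (mulIf (lt0r_neq0 phi0)); rewrite -/bound; lra.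
have attained : regular p /\ incenter p 0 -> S_phi p phi = bound.
  move=> [reg [r' inc']].
  have /(regularE cc inc') ht := reg.
  have [rE LE] := inradius_equiangular cc inc' ht.
  rewrite S_phiE // /bound -LE -rE mulr_suml; apply: eq_bigr => i _.
  by rewrite (incircle_cross cc _ inc').
split=> //; first by lra.
- move=> naff; split=> // e.
  have ht := extremal e; have [rE LE] := inradius_equiangular cc inc ht.
  split; first exact/(regularE cc inc).
  have <- : c = 0; last by exists r.
  apply: Seq; first by rewrite rE.
  by rewrite e /bound -LE rE.
- by move=> /extremal ht; exact/(regularE cc inc).
Qed.
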